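(* Let $n\ge 1$ and let $X=(X_1,\ldots,X_n)$ be a random vector uniformly distributed over $\{-1,1\}^n$. Given nonzero weights $w_1,\ldots,w_n\in\mathbb{R}$ and a threshold $t\in\mathbb{R}$, consider the weighted majority function $f:\mathbb{R}^n\to\{-1,0,1\}$ defined by $$f(x)=\operatorname{sgn}\Bigl(\sum_{i=1}^n w_i x_i-t\Bigr).$$ Then for $0\le\epsilon\le 1/2$, $$p_\epsilon(n,w,t):=\mathbf{P}\bigl(f(X)\ne f(N_\epsilon(X))\bigr)\le 2\epsilon^{1/2}.$$ Moreover, the quantity $$p_\epsilon^*:=\limsup_{n\to\infty}\ \sup_{w,t}\ p_\epsilon(n,w,t),$$ where the supremum is over all vectors $w=(w_1,\ldots,w_n)\in\mathbb{R}^n$ with all coordinates nonzero and all $t\in\mathbb{R}$, satisfies $$\limsup_{\epsilon\to 0^+}\frac{p_\epsilon^*}{\sqrt{\epsilon}}\le\sqrt{2/\pi}.$$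
   Context: The sign function takes three values: $\operatorname{sgn}(u)=u/|u|$ for $u\neq 0$ and $\operatorname{sgn}(0)=0$. For $\epsilon\in[0,1]$ the noise operator $N_\epsilon$ flips each coordinate of its input independently with probability $\epsilon$: given a random vector $X=(X_1,\ldots,X_n)$, the random vector $N_\epsilon(X)$ is $(\sigma_1X_1,\ldots,\sigma_nX_n)$, where $\sigma_1,\ldots,\sigma_n$ are i.i.d. random variables, independent of $X$, taking the value $1$ with probability $1-\epsilon$ and the value $-1$ with probability $\epsilon$. *)

(* Defs.v *)
From HB Require Import structures.
From mathcomp Require Import all_boot all_order all_algebra.
From mathcomp Require Import all_classical all_reals all_analysis.
Set Implicit Arguments.
Unset Strict Implicit.
Unset Printing Implicit Defensive.
Import Order.TTheory GRing.Theory Num.Theory.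
Import numFieldNormedType.Exports.
Local Open Scope classical_set_scope.
Local Open Scope ring_scope.

(* [Num.sg 0 = 0], so the values of [weighted_majority w t] are -1, 0, 1. *)
Definition weighted_majority (R : realType) (n : nat) (w : n.-tuple R) (t : R)
    (x : n.-tuple R) : R :=
  Num.sg (\sum_(i < n) tnth w i * tnth x i - t).

Definition nonzero_weights (R : realType) (n : nat) : set (n.-tuple R) :=
  [set w | forall i, tnth w i != 0].

Definition sign_vectors (R : realType) (n : nat) : set (n.-tuple R) :=
  [set x | forall i, tnth x i = 1 \/ tnth x i = -1].

Definition coordinatewise_mul (R : realType) (n : nat) (s x : n.-tuple R) :
    n.-tuple R :=
  [tuple tnth s i * tnth x i | i < n].

Section RandomVectors.
Context (R : realType) (d : measure_display) (T : measurableType d).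
Context (P : probability T R) (n : nat).
Implicit Types X Y sigma : {RV P >-> n.-tuple R}.

(* The 2 ^ n values below have total mass 1, so X is almost surely in
   [sign_vectors]. *)
Definition uniform_on_signs X : Prop :=
  forall x, sign_vectors x -> P (X @^-1` [set x]) = (2 ^- n)%:E.

Definition independent_coordinates X : Prop :=
  forall (J : {set 'I_n}) (B : 'I_n -> set R),
    (forall i, measurable (B i)) ->
    P [set o | forall i, i \in J -> B i (tnth (X o) i)] =
    (\prod_(i in J) P [set o | B i (tnth (X o) i)])%E.

Definition independent_vectors X Y : Prop :=
  forall A B : set (n.-tuple R), measurable A -> measurable B ->
    P (X @^-1` A `&` Y @^-1` B) = (P (X @^-1` A) * P (Y @^-1` B))%E.

Definition random_flips (eps : R) sigma : Prop :=
  independent_coordinates sigma /\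
  forall i : 'I_n,
    P [set o | tnth (sigma o) i = 1] = (1 - eps)%:E /\
    P [set o | tnth (sigma o) i = -1] = eps%:E.

Definition noise_model (eps : R) X sigma : Prop :=
  [/\ uniform_on_signs X, random_flips eps sigma & independent_vectors X sigma].

Definition noise_operator sigma X (o : T) : n.-tuple R :=
  coordinatewise_mul (sigma o) (X o).

Definition noise_sensitivity X sigma (w : n.-tuple R) (t : R) : \bar R :=
  P [set o | weighted_majority w t (X o) <>
             weighted_majority w t (noise_operator sigma X o)].

End RandomVectors.

Definition limsup_worst_case (R : realType)
    (p : forall n : nat, n.-tuple R -> R -> \bar R) : \bar R :=
  limn_esup (fun n =>
    ereal_sup [set p n w t | w in @nonzero_weights R n & t in [set: R]]).

(* Main.v *)
Require Import Defs.
From HB Require Import structures.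
From mathcomp Require Import all_boot all_order all_algebra.
From mathcomp Require Import all_classical all_reals all_analysis measurable_realfun.
From mathcomp Require Import lra ring zify.
Import Order.TTheory GRing.Theory Num.Theory.
Import numFieldNormedType.Exports.
Local Open Scope classical_set_scope.
Local Open Scope ring_scope.

(* Fix m with m * eps <= 1 and put each coordinate into one of m blocks, with
   probability eps for each block, or into no block. Flipping the signs in one
   given block is exactly the noise N_eps, and for a fixed assignment and a
   fixed x the majority restricted to the block flips of x is a weighted
   majority in m signs. The total influence of a weighted majority in m signs
   is at most that of the unweighted one, E |S_m| with S_m a sum of m uniform
   signs, because it is unate. Averaging over the blocks gives
   E |f(X) - f(N_eps X)| <= 2 E |S_m| / m, and E |S_m| / m is the central
   binomial probability 'C(2k, k) / 4 ^ k for k = m./2; Wallis' inequality and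
   m ~ 1 / eps give the bounds. For the sharp constant, a disagreement of f
   changes f by 2 unless f vanishes at one of the two points, and for nonzero
   weights P(f = 0) <= E |S_n| / n, again by the influence bound. *)

(** * Total influence of a weighted majority on the Boolean cube *)

Section Cube.
Context {R : realFieldType}.

(** The bit [true] stands for the sign -1, so products of sign vectors become addition modulo 2. *)
Definition flip {I : finType} (x e : {ffun I -> bool}) : {ffun I -> bool} :=
  [ffun i => x i (+) e i].

Definition unit_flip {I : finType} (i : I) : {ffun I -> bool} :=
  [ffun j => j == i].

Definition cube_majority {I : finType} (w : I -> R) (t : R)
    (x : {ffun I -> bool}) : R :=
  Num.sg (\sum_i w i * (-1) ^+ x i - t).

(** Left unnormalised: 2 ^ #|I| times the mean of |S|, with S a sum of #|I| uniform signs. *)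
Definition sign_sum_abs (I : finType) : R :=
  \sum_(x : {ffun I -> bool}) `|\sum_i (-1) ^+ x i|.

Definition noise_weight {I : finType} (eps : R) (e : {ffun I -> bool}) : R :=
  \prod_i (if e i then eps else 1 - eps).

Lemma natr_card_cube (I : finType) : #|{ffun I -> bool}|%:R = 2 ^+ #|I| :> R.
Proof. by rewrite card_ffun card_bool natrX. Qed.

Lemma flipK {I : finType} (e : {ffun I -> bool}) : involutive (flip^~ e).
Proof. by move=> x; apply/ffunP => i; rewrite !ffunE addbK. Qed.

Lemma sum_flip {I : finType} (e : {ffun I -> bool}) (g : {ffun I -> bool} -> R) :
  \sum_x g (flip x e) = \sum_x g x.
Proof. by rewrite [RHS](reindex_inj (inv_inj (flipK e))). Qed.

Lemma sgr_le (a b : R) : a <= b -> Num.sg a <= Num.sg b.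
Proof. by move=> ab; case: (sgrP a); case: (sgrP b) => //; lra. Qed.

(* The majority is monotone in coordinate [i], in the direction given by the
   sign of [w i], so the absolute increment is a signed increment. *)
Lemma cube_majority_increment {I : finType} (w : I -> R) t x i :
  `|cube_majority w t x - cube_majority w t (flip x (unit_flip i))| =
  (-1) ^+ (x i (+) (w i < 0)) *
    (cube_majority w t x - cube_majority w t (flip x (unit_flip i))).
Proof.
rewrite /cube_majority (bigD1 i) //= [in X in _ - X](bigD1 i) //=.
set S := \sum_(j | _) _; set S' := \sum_(j | _) _.
have -> : S' = S.
  by apply: eq_bigr => j ji; rewrite !ffunE (negbTE ji) addbF.
rewrite !ffunE eqxx addbT.
have H := @sgr_le; case: (x i); case: (ltP (w i) 0) => wi /=;
  rewrite ?expr0 ?expr1 ?mulrN1 ?mulr1 ?mul1r ?mulN1r.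
- by apply: ger0_norm; rewrite subr_ge0; apply: H; lra.
- by apply: ler0_norm; rewrite subr_le0; apply: H; lra.
- by apply: ler0_norm; rewrite subr_le0; apply: H; lra.
- by apply: ger0_norm; rewrite subr_ge0; apply: H; lra.
Qed.

Lemma normr_cube_majority_le1 {I : finType} (w : I -> R) t x :
  `|cube_majority w t x| <= 1.
Proof. by rewrite /cube_majority normr_sg; case: eqP. Qed.

(** Summing the signed increments by parts gives twice the correlation of the majority with a signed
    sum of coordinates. The majority is at most 1 in absolute value, and translating by the sign
    pattern of [w] turns the remaining sum into [sign_sum_abs]. *)
Lemma total_influence_le {I : finType} (w : I -> R) (t : R) :
  \sum_x \sum_i
    `|cube_majority w t x - cube_majority w t (flip x (unit_flip i))|
  <= 2 * sign_sum_abs I.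
Proof.
pose F := cube_majority w t; pose s : {ffun I -> bool} := [ffun i => w i < 0].
have -> : \sum_x \sum_i `|F x - F (flip x (unit_flip i))| =
    2 * \sum_x F x * \sum_i (-1) ^+ flip x s i.
  under eq_bigr do under eq_bigr do rewrite cube_majority_increment mulrBr.
  rewrite exchange_big /= mulr_sumr.
  under [RHS]eq_bigr do rewrite mulr_sumr mulr_sumr.
  rewrite [RHS]exchange_big /=; apply: eq_bigr => i _.
  rewrite big_split /= sumrN.
  (* Flipping coordinate i in the summation variable reverses its sign, so the two halves of the
     increment contribute equally. *)
  rewrite -(sum_flip (unit_flip i) (fun x => _ * cube_majority w t (flip x _))).
  rewrite -sumrN -big_split /=; apply: eq_bigr => x _.
  by rewrite flipK !ffunE eqxx addbT addNb signrN /F; ring.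
rewrite ler_pM2l // /sign_sum_abs -[leRHS](sum_flip s).
apply: ler_sum => x _; apply: le_trans (ler_norm _) _.
by rewrite normrM ler_piMl // normr_cube_majority_le1.
Qed.

(** At the two ends of an edge in direction i the linear forms differ by 2 w_i up to sign, so at
    most one end is a zero of the majority, and then the increment along the edge has absolute value
    1. *)
Lemma zero_set_le {n : nat} (w : 'I_n -> R) (t : R) : (forall i, w i != 0) ->
  n%:R * \sum_x (cube_majority w t x == 0)%:R <= sign_sum_abs 'I_n.
Proof.
move=> w0; rewrite -(ler_pM2l (ltr0Sn R 1)).
apply: le_trans (total_influence_le w t).
pose F := cube_majority w t; rewrite -/F.
have -> : n%:R * (\sum_x (F x == 0)%:R) =
    \sum_x \sum_(i < n) ((F x == 0)%:R : R).
  rewrite mulr_sumr; apply: eq_bigr => x _.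
  by rewrite sumr_const card_ord mulr_natl.
rewrite exchange_big [leRHS]exchange_big /= mulr_sumr ler_sum // => i _.
rewrite mulr_natl mulr2n -{1}(sum_flip (unit_flip i)) -big_split /=.
apply: ler_sum => x _; set y := flip _ _.
have : ~~ ((F x == 0) && (F y == 0)).
  apply/negP => /andP[]; rewrite !sgr_eq0 !subr_eq0 => /eqP <-.
  rewrite (bigD1 i) //= [eqbRHS](bigD1 i) //=.
  rewrite (eq_bigr (fun j => w j * (-1) ^+ x j)); last first.
    by move=> j ji; rewrite !ffunE (negbTE ji) addbF.
  rewrite !ffunE eqxx addbT signrN mulrN (inj_eq (addIr _)).
  by rewrite eq_sym -addr_eq0 -mulr2n mulrn_eq0 mulf_eq0 signr_eq0 (negbTE (w0 i)).
have F1 z : F z != 0 -> `|F z| = 1 by rewrite /F /cube_majority sgr_eq0 normr_sg => ->.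
case: (eqVneq (F x) 0) => [-> | /F1 Fx]; case: (eqVneq (F y) 0) => [-> | /F1 Fy] //= _.
- by rewrite sub0r normrN Fy add0r.
- by rewrite subr0 Fx addr0.
- by rewrite add0r normr_ge0.
Qed.

End Cube.

(** * Noise realised by random blocks of coordinates *)

Section Blocks.
Context {R : realFieldType} {I : finType} {m : nat}.

(* [a i = Some j] puts coordinate [i] into block [j]; [a i = None] leaves it out
   of all blocks. *)
Definition block_flip (a : {ffun I -> option 'I_m}) (b : {ffun 'I_m -> bool}) :
    {ffun I -> bool} :=
  [ffun i => if a i is Some j then b j else false].

(** [None] receives the mass left over by the m blocks, which is nonnegative when m * eps <= 1. *)
Definition block_weight (eps : R) (o : option 'I_m) : R :=
  if o is Some _ then eps else 1 - m%:R * eps.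

Lemma sum_block_weight (eps : R) : \sum_o block_weight eps o = 1.
Proof.
rewrite (bigD1 None) //= (reindex_omap (@Some _) id) /=; last by case.
under eq_bigl do rewrite eqxx.
by rewrite sumr_const card_ord mulr_natl subrK.
Qed.

Lemma block_flip_unit_flip a j i : block_flip a (unit_flip j) i = (a i == Some j).
Proof. by rewrite ffunE; case: (a i) => //= k; rewrite ffunE. Qed.

(** Each coordinate falls into block j independently with weight eps, so the indicator of that block
    is distributed as the noise. *)
Lemma sum_noise_weight_block (eps : R) (j : 'I_m) (g : {ffun I -> bool} -> R) :
  \sum_e noise_weight eps e * g e =
  \sum_(a : {ffun I -> option 'I_m})
    (\prod_i block_weight eps (a i)) * g (block_flip a (unit_flip j)).
Proof.
rewrite [RHS](partition_big (block_flip^~ (unit_flip j)) predT) //=.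
apply: eq_bigr => e _.

transitivity (\sum_(a | block_flip a (unit_flip j) == e)
    (\prod_i block_weight eps (a i)) * g e); last first.
  by apply: eq_bigr => a /eqP ->.
rewrite -mulr_suml; congr (_ * _).
(* The assignments with a prescribed block j form a product set, so their total weight factors over
   the coordinates. *)
rewrite (eq_bigl (fun a => a \in family (fun i o => (o == Some j) == e i))); last first.
  move=> a; apply/eqP/familyP => [<- i | H].
    by rewrite unfold_in block_flip_unit_flip eqxx.
  by apply/ffunP => i; have := H i; rewrite block_flip_unit_flip unfold_in => /eqP.
rewrite -(bigA_distr_big_dep _ (fun _ => block_weight eps)).
apply: eq_bigr => i _; case: (e i).
  by rewrite (big_pred1 (Some j)) // => o; rewrite eqb_id.
have := sum_block_weight eps; rewrite (bigD1 (Some j)) //= => <-.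
by rewrite addrC addrK; apply: eq_bigl => o; rewrite eqbF_neg.
Qed.

Lemma flip_block_flip a x b c :
  flip (flip x (block_flip a b)) (block_flip a c) = flip x (block_flip a (flip b c)).
Proof.
apply/ffunP => i; rewrite !ffunE -addbA; congr (_ (+) _).
by case: (a i) => //= k; rewrite !ffunE.
Qed.

(** Each block acts as a single sign, weighted by its share of the linear form at x; the coordinates
    outside all blocks are absorbed by the threshold. *)
Lemma cube_majority_block_flip (w : I -> R) t a x b :
  cube_majority w t (flip x (block_flip a b)) =
  cube_majority (fun j => \sum_(i | a i == Some j) w i * (-1) ^+ x i)
    (t - \sum_(i | a i == None) w i * (-1) ^+ x i) b.
Proof.
rewrite /cube_majority; congr Num.sg; rewrite opprB addrA; congr (_ - _).
rewrite (partition_big a predT) //= (bigD1 None) //= addrC; congr (_ + _).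
  rewrite (reindex_omap (@Some _) id) /=; last by case.
  under eq_bigl do rewrite eqxx.
  apply: eq_bigr => j _; rewrite mulr_suml; apply: eq_bigr => i /eqP aij.
  by rewrite !ffunE aij signr_addb mulrA.
by apply: eq_bigr => i /eqP ai; rewrite !ffunE ai addbF.
Qed.

(** The factor m lets every block realise the noise once. For a fixed assignment and a fixed x, what
    remains is the total influence of a majority in m signs. *)
Lemma noise_increment_le (w : I -> R) t (eps : R) : 0 <= eps -> m%:R * eps <= 1 ->
  m%:R * 2 ^+ m * \sum_e noise_weight eps e *
    \sum_x `|cube_majority w t x - cube_majority w t (flip x e)|
  <= 2 ^+ #|I| * (2 * sign_sum_abs 'I_m).
Proof.
move=> eps0 meps; pose F := cube_majority w t.
pose g e := \sum_x `|F x - F (flip x e)|; rewrite -/g.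
have -> : m%:R * 2 ^+ m * (\sum_e noise_weight eps e * g e) =
   \sum_(a : {ffun I -> option 'I_m}) (\prod_i block_weight eps (a i)) *
     (2 ^+ m * \sum_j g (block_flip a (unit_flip j))).
  transitivity (2 ^+ m * \sum_(j < m) \sum_e noise_weight eps e * g e).
    by rewrite sumr_const card_ord mulrnAr -mulrA mulr_natl.
  under eq_bigr => j _ do rewrite (sum_noise_weight_block eps j g).
  rewrite exchange_big /= mulr_sumr; apply: eq_bigr => a _.
  by rewrite -mulr_sumr mulrCA.
have w1 : \sum_(a : {ffun I -> option 'I_m}) \prod_i block_weight eps (a i) = 1.
  rewrite -(bigA_distr_bigA (fun _ => block_weight eps)).
  by rewrite big1 // => i _; rewrite sum_block_weight.
rewrite -[leRHS]mul1r -[X in _ <= X * _]w1 mulr_suml; apply: ler_sum => a _.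
apply: ler_wpM2l.
  by apply: prodr_ge0 => i _; case: (a i) => //=; rewrite subr_ge0.
(* The factor 2 ^ m counts the choices of b; translating x by [block_flip a b] leaves each sum over
   x unchanged. *)
have -> : 2 ^+ m * (\sum_j g (block_flip a (unit_flip j))) =
  \sum_x \sum_(b : {ffun 'I_m -> bool}) \sum_j
    `|F (flip x (block_flip a b)) - F (flip x (block_flip a (flip b (unit_flip j))))|.
  rewrite [RHS]exchange_big /= -[X in 2 ^+ X]card_ord -natr_card_cube.
  rewrite mulr_natl -sumr_const.
  apply: eq_bigr => b _; rewrite [RHS]exchange_big; apply: eq_bigr => j _ /=.
  rewrite /g -(sum_flip (block_flip a b)).
  by apply: eq_bigr => x _; rewrite flip_block_flip.
rewrite -natr_card_cube mulr_natl -sumr_const; apply: ler_sum => x _.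
under eq_bigr do under eq_bigr do rewrite /F !cube_majority_block_flip.
exact: total_influence_le.
Qed.

End Blocks.

(** * Disagreement counted on the cube *)

Section Disagreement.
Context {R : realFieldType} {I : finType} (w : I -> R) (t eps : R).
Hypothesis eps01 : 0 <= eps <= 1.
Let F := cube_majority w t.

(** The sum over x is a plain count, so this is 2 ^ #|I| times the disagreement probability. *)
Definition disagreement : R :=
  \sum_e noise_weight eps e * \sum_x (F x != F (flip x e))%:R.

Lemma noise_weight_ge0 (e : {ffun I -> bool}) : 0 <= noise_weight eps e.
Proof. by case/andP: eps01 => *; apply: prodr_ge0 => i _; case: (e i); lra. Qed.

Lemma sum_noise_weight : \sum_(e : {ffun I -> bool}) noise_weight eps e = 1.
Proof.
rewrite -(bigA_distr_bigA (fun _ (b : bool) => if b then eps else 1 - eps)).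
by rewrite big1 // => i _; rewrite big_bool /= addrC subrK.
Qed.

Lemma disagreement_le_increment : disagreement <=
  \sum_e noise_weight eps e * \sum_x `|F x - F (flip x e)|.
Proof.
apply: ler_sum => e _; apply: ler_wpM2l; first exact: noise_weight_ge0.
apply: ler_sum => x _; rewrite /F /cube_majority.
by case: sgrP => _; case: sgrP => _; case: eqVneq => H /=;
  rewrite ?ler_norml ?ler_normr; lra.
Qed.

(** For values a, b in {-1, 0, 1}, 2 [a <> b] <= |a - b| + [a = 0] + [b = 0]. The two zero counts
    agree after summing over x, since a flip permutes the cube. *)
Lemma double_disagreement_le : 2 * disagreement <=
  \sum_e noise_weight eps e * (\sum_x `|F x - F (flip x e)|) +
  2 * \sum_x (F x == 0)%:R.
Proof.
rewrite -[X in _ + X]mul1r -[X in _ + X * _]sum_noise_weight.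
rewrite mulr_suml -big_split /= mulr_sumr.
apply: ler_sum => e _; rewrite mulrCA -mulrDr; apply: ler_wpM2l.
  exact: noise_weight_ge0.
have -> : 2 * \sum_x (F x == 0)%:R =
    \sum_x ((F x == 0)%:R + (F (flip x e) == 0)%:R) :> R.
  by rewrite big_split /= (sum_flip e (fun x => (F x == 0)%:R)) mulr_natl mulr2n.
rewrite mulr_sumr -big_split /=; apply: ler_sum => x _.
rewrite /F /cube_majority.
by case: sgrP => _; case: sgrP => _; case: eqVneq => H /=;
  rewrite ?eqxx ?oppr_eq0 ?oner_eq0 ?subrr ?sub0r ?subr0 ?opprK ?normrN;
  rewrite ?normr1 ?normr0 /=;
  rewrite ?(ger0_norm (_ : 0 <= 1 + 1 :> R)) // ?(ler0_norm (_ : -1 -1 <= 0 :> R)) //; lra.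
Qed.

End Disagreement.

(** * Mean absolute value of a sum of signs *)

Section SignSum.
Context {R : realFieldType}.

Definition ffun_cons {m : nat} (b : bool) (y : {ffun 'I_m -> bool}) :
    {ffun 'I_m.+1 -> bool} :=
  [ffun i => if unlift ord0 i is Some j then y j else b].

Lemma sum_cube_recl m (g : nat -> R) :
  \sum_(x : {ffun 'I_m.+1 -> bool}) g (\sum_i x i)%N =
  \sum_(y : {ffun 'I_m -> bool}) (g (\sum_i y i).+1%N + g (\sum_i y i)%N).
Proof.
rewrite (reindex (fun p : bool * {ffun 'I_m -> bool} => ffun_cons p.1 p.2)) /=; last first.
  exists (fun x : {ffun 'I_m.+1 -> bool} => (x ord0, [ffun j => x (lift ord0 j)])).
    move=> [b y] _; rewrite ffunE unlift_none; congr pair.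
    by apply/ffunP => j; rewrite !ffunE liftK.
  move=> x _; apply/ffunP => i; rewrite !ffunE.
  by case: unliftP => [j ->|->]; rewrite ?ffunE.
rewrite -(pair_bigA _ (fun b y => g (\sum_i ffun_cons b y i)%N)) /=.
rewrite big_bool /= -big_split; apply: eq_bigr => y _ /=.
have E b : (\sum_i ffun_cons b y i = b + \sum_i y i)%N.
  rewrite big_ord_recl ffunE unlift_none; congr addn.
  by apply: eq_bigr => j _; rewrite ffunE liftK.
by rewrite !E.
Qed.

Lemma sum_cube_eq m k :
  \sum_(x : {ffun 'I_m -> bool}) ((\sum_i x i)%N == k)%:R = 'C(m, k)%:R :> R.
Proof.
elim: m k => [|m IH] k.
  rewrite (big_pred1 [ffun=> false]); last first.
    by move=> x; apply/esym/eqP/ffunP => -[].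
  by rewrite big_ord0 bin0n eq_sym.
rewrite (sum_cube_recl m (fun j => (j == k)%:R)) big_split /= IH.
case: k => [|k]; first by rewrite !bin0 big1 ?add0r.
by rewrite binS natrD -[X in _ = _ + X]IH addrC; congr (_ + _); apply: eq_bigr => x _.
Qed.

Lemma sum_signs m (x : {ffun 'I_m -> bool}) :
  \sum_i (-1) ^+ x i = m%:R - 2 * (\sum_i x i)%N%:R :> R.
Proof.
rewrite natr_sum mulr_sumr -[X in X%:R - _]card_ord -sumr_const -sumrB.
by apply: eq_bigr => i _; case: (x i); rewrite /= ?expr1 ?expr0; lra.
Qed.

(** For an integer S, |S + 1| + |S - 1| exceeds 2 |S| only at S = 0, and then by 2. A sum of m signs
    vanishes only for even m, at ['C(m, m./2)] points. *)
Lemma sign_sum_abs_recl m :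
  sign_sum_abs 'I_m.+1 =
  2 * sign_sum_abs 'I_m + 2 * (~~ odd m)%:R * 'C(m, m./2)%:R :> R.
Proof.
rewrite /sign_sum_abs; under eq_bigr do rewrite sum_signs.
under [in RHS]eq_bigr do rewrite sum_signs.
rewrite (sum_cube_recl m (fun j => `|m.+1%:R - 2 * j%:R|)).
rewrite -mulrA -sum_cube_eq !mulr_sumr -big_split /=.
apply: eq_bigr => x _; move: (\sum_i x i)%N => s.
rewrite -[m in RHS]odd_double_half oddD odd_double addbF oddb half_bit_double.
rewrite -[m in LHS]odd_double_half; move: (odd m) (m./2) => b h.
rewrite -!natr1 -muln2 natrD natrM.
case: b => /=; last case: ltngtP => [sh|hs|->] /=.
- case: (leqP s h) => sh.
    have {}sh : s%:R <= h%:R :> R by rewrite ler_nat.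
    by do 3 case: ger0P => ?; lra.
  have {}sh : h%:R + 1 <= s%:R :> R by rewrite natr1 ler_nat.
  by do 3 case: ger0P => ?; lra.
- have {}sh : s%:R + 1 <= h%:R :> R by rewrite natr1 ler_nat.
  by do 3 case: ger0P => ?; lra.
- have {}hs : h%:R + 1 <= s%:R :> R by rewrite natr1 ler_nat.
  by do 3 case: ger0P => ?; lra.
- by do 3 case: ger0P => ?; lra.
Qed.

(** The probability that 2k uniform signs sum to 0, as [central_binomial] shows. *)
Definition wallis_ratio (k : nat) : R :=
  \prod_(i < k) ((2 * i%:R + 1) / (2 * i%:R + 2)).

Lemma wallis_ratioS k :
  wallis_ratio k.+1 = wallis_ratio k * ((2 * k%:R + 1) / (2 * k%:R + 2)).
Proof. exact: big_ord_recr. Qed.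

Lemma central_binomial k : 'C(k.*2, k)%:R = 4 ^+ k * wallis_ratio k :> R.
Proof.
elim: k => [|k IH]; first by rewrite /wallis_ratio big_ord0 mulr1.
rewrite wallis_ratioS exprS.
have k1 : k.+1%:R != 0 :> R by rewrite pnatr_eq0.
have -> : 'C(k.+1.*2, k.+1)%:R =
    2 * (2 * k%:R + 1) / k.+1%:R * 'C(k.*2, k)%:R :> R.
  apply: (mulfI k1); apply: (mulfI k1).
  have e1 : (k.+1 * 'C(k.+1.*2, k.+1) = k.+1.*2 * 'C(k.*2.+1, k.+1))%N.
    rewrite -mul_bin_diag doubleS /=; congr muln.
    rewrite -(@bin_sub k.*2.+1 k.+1); last by lia.
    by congr 'C(_, _); lia.
  have e2 : (k.+1 * 'C(k.*2.+1, k.+1) = k.*2.+1 * 'C(k.*2, k))%N.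
    by rewrite -mul_bin_diag.
  have {}e1 : k.+1%:R * 'C(k.+1.*2, k.+1)%:R =
      k.+1.*2%:R * 'C(k.*2.+1, k.+1)%:R :> R by rewrite -!natrM e1.
  have {}e2 : k.+1%:R * 'C(k.*2.+1, k.+1)%:R =
      k.*2.+1%:R * 'C(k.*2, k)%:R :> R by rewrite -!natrM e2.
  rewrite e1 mulrCA e2 -!muln2 -!natr1 !natrM -natr1 in k1 *.
  by field.
rewrite IH -natr1; field.
have k0 : 0 <= k%:R :> R by rewrite ler0n.
by apply/andP; split; apply: lt0r_neq0; lra.
Qed.

Lemma sign_sum_absE m :
  sign_sum_abs 'I_m = m%:R * 2 ^+ m * wallis_ratio m./2 :> R.
Proof.
(* Both parities go through one induction: the recursion adds a central binomial term only when
   leaving an even index. *)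
have E k : sign_sum_abs 'I_(k.*2) = k.*2%:R * 2 ^+ k.*2 * wallis_ratio k :> R /\
           sign_sum_abs 'I_(k.*2.+1) = k.*2.+1%:R * 2 ^+ k.*2.+1 * wallis_ratio k :> R.
  elim: k => [|k [_ IH]].
    split.
      rewrite mul0r mul0r /sign_sum_abs big1 // => x _.
      by rewrite big_ord0 normr0.
    rewrite sign_sum_abs_recl /= /sign_sum_abs big1 ?mulr0 ?add0r ?mulr1.
      by rewrite /wallis_ratio big_ord0 double0 expr1 mulr1 mul1r.
    by move=> x _; rewrite big_ord0 normr0.
  have E2 : sign_sum_abs 'I_(k.+1.*2) = k.+1.*2%:R * 2 ^+ k.+1.*2 * wallis_ratio k.+1 :> R.
    rewrite doubleS sign_sum_abs_recl /= odd_double mulr0 mul0r addr0 IH.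
    rewrite wallis_ratioS [2 ^+ k.*2.+2]exprS -muln2 -!natr1 natrM; field.
    have k0 : 0 <= k%:R :> R by rewrite ler0n.
    by apply: lt0r_neq0; lra.
  split=> //; rewrite sign_sum_abs_recl /= odd_double doubleK E2.
  rewrite central_binomial /= mulr1 [2 ^+ k.+1.*2.+1]exprS.
  have -> : 2 ^+ k.+1.*2 = 4 ^+ k.+1 :> R.
    by rewrite -mul2n exprM expr2; congr (_ ^+ _); ring.
  by rewrite -[k.+1.*2.+1%:R]natr1; ring.
have [Ee Eo] := E m./2; rewrite -[m]odd_double_half.
by case: (odd m); rewrite ?add1n ?add0n ?Ee ?Eo /= ?uphalf_double ?doubleK.
Qed.

End SignSum.

(** * Disagreement bounded by Wallis ratios *)

Section DisagreementBounds.
Context {R : realFieldType}.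

Lemma wallis_ratio_gt0 k : 0 < wallis_ratio k :> R.
Proof.
apply: prodr_gt0 => i _; have i0 : 0 <= (i : nat)%:R :> R by rewrite ler0n.
by apply: divr_gt0; lra.
Qed.

(** The left side decreases in k and equals 1 at k = 0. The shift by one matters: the same
    expression with ratio index 0 would be 2. *)
Lemma sqr_wallis_ratio_le k : wallis_ratio k.+1 ^+ 2 * (2 * k.+1%:R + 2) <= 1 :> R.
Proof.
elim: k => [|k]; first by rewrite /wallis_ratio big_ord1 mulr0 !add0r mul1r; lra.
apply: le_trans; rewrite [wallis_ratio k.+2]wallis_ratioS exprMn -mulrA.
apply: ler_wpM2l; first exact: sqr_ge0.
have : 1 <= k.+1%:R :> R by rewrite ler1n.
rewrite -[k.+2%:R]natr1; move: k.+1%:R => y y1.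
by rewrite expr_div_n mulrAC ler_pdivrMr ?exprn_gt0; nra.
Qed.

Lemma increment_le_wallis {I : finType} (w : I -> R) (t eps : R) m :
  (0 < m)%N -> 0 <= eps -> m%:R * eps <= 1 ->
  \sum_e noise_weight eps e *
    \sum_x `|cube_majority w t x - cube_majority w t (flip x e)|
  <= 2 ^+ #|I| * (2 * wallis_ratio m./2).
Proof.
move=> m0 eps0 meps; have := noise_increment_le w t _ eps0 meps.
have m2 : 0 < m%:R * 2 ^+ m :> R by rewrite mulr_gt0 ?exprn_gt0 ?ltr0n.
rewrite sign_sum_absE => H; rewrite -(ler_pM2l m2).
by rewrite [leRHS](_ : _ =
  2 ^+ #|I| * (2 * (m%:R * 2 ^+ m * wallis_ratio m./2))) //; ring.
Qed.

Lemma disagreement_le {I : finType} (w : I -> R) (t eps : R) m :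
  (0 < m)%N -> 0 <= eps <= 1 -> m%:R * eps <= 1 ->
  disagreement w t eps <= 2 ^+ #|I| * (2 * wallis_ratio m./2).
Proof.
move=> m0 eps01 meps; apply: le_trans (disagreement_le_increment w t _ eps01) _.
by apply: increment_le_wallis => //; case/andP: eps01.
Qed.

(** Compared with [disagreement_le], the main term is halved at the cost of a term that vanishes as
    n grows. *)
Lemma disagreement_nonzero_weights_le {n : nat} (w : 'I_n -> R) (t eps : R) m :
  (0 < n)%N -> (forall i, w i != 0) ->
  (0 < m)%N -> 0 <= eps <= 1 -> m%:R * eps <= 1 ->
  disagreement w t eps <= 2 ^+ n * (wallis_ratio m./2 + wallis_ratio n./2).
Proof.
move=> n0 w0 m0 eps01 meps.
have := double_disagreement_le w t _ eps01.
have eps0 : 0 <= eps by case/andP: eps01.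
have := increment_le_wallis w t _ _ m0 eps0 meps; rewrite card_ord.
have : \sum_x ((cube_majority w t x == 0)%:R : R) <= 2 ^+ n * wallis_ratio n./2.
  have n0R : 0 < n%:R :> R by rewrite ltr0n.
  by rewrite -(ler_pM2l n0R) mulrA -sign_sum_absE zero_set_le.
by lra.
Qed.

End DisagreementBounds.

(** * Wallis' inequality with the constant pi *)

Section Wallis.
Context {R : realType}.

(** The reduction formula for the antiderivative of cos ^ n that vanishes at 0; its value at pi / 2
    is the Wallis integral. *)
Fixpoint cos_primitive (n : nat) (x : R) : R :=
  match n with
  | 0 => x
  | 1 => sin x
  | k.+2 => (k.+2%:R)^-1 * (cos x ^+ k.+1 * sin x + k.+1%:R * cos_primitive k x)
  end.

Lemma is_derive_cos_primitive n (x : R) :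
  is_derive x 1 (cos_primitive n) (cos x ^+ n).
Proof.
elim/ltn_ind: n => -[|[|k]] IH.
- rewrite expr0; exact: is_derive_id.
- rewrite expr1; exact: is_derive_sin.
have {}IH : is_derive x 1 (cos_primitive k) (cos x ^+ k) by exact: IH.
have -> : cos_primitive k.+2 = (k.+2%:R)^-1 \*:
   ((@cos R ^+ k.+1) * @sin R + k.+1%:R \*: cos_primitive k).
  by apply/funext => y; rewrite /= !fctE.
apply: is_derive_eq.
have k2 : k.+2%:R != 0 :> R by rewrite pnatr_eq0.
have scaleE (a b : R) : a *: (b : R^o) = a * b by [].
rewrite fctE /= !scaleE.
have s2 : sin x ^+ 2 = 1 - cos x ^+ 2 by rewrite -(cos2Dsin2 x) addrAC subrr add0r.
apply: (mulfI k2); rewrite mulVKf //.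
transitivity (cos x ^+ k.+2 + k.+1%:R * cos x ^+ k * (1 - sin x ^+ 2)).
  by rewrite !exprS; ring.
rewrite s2 -[k.+2%:R]natr1 !exprS; ring.
Qed.

Lemma cos_primitive0 n : cos_primitive n 0 = 0.
Proof.
elim/ltn_ind: n => -[|[|k]] IH //=; first exact: sin0.
by rewrite IH // sin0 !mulr0 addr0 mulr0.
Qed.

(** The difference of the two primitives has derivative cos ^ n * (1 - cos), nonnegative on
    [0, pi / 2]. *)
Lemma cos_primitive_pihalf_le n :
  cos_primitive n.+1 (pi / 2) <= cos_primitive n (pi / 2).
Proof.
pose G (x : R) := cos_primitive n x - cos_primitive n.+1 x.
have dG (x : R) : is_derive x 1 G (cos x ^+ n - cos x ^+ n.+1).
  apply: is_deriveB; exact: is_derive_cos_primitive.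
have pi2 : 0 < pi / 2 :> R by rewrite divr_gt0 // pi_gt0.
have cG : {within `[0, pi / 2], continuous G}.
  apply: continuous_subspaceT => x; apply: differentiable_continuous.
  by apply/derivable1_diffP; apply: ex_derive.
have [c] := MVT pi2 (fun x _ => dG x) cG.
rewrite in_itv /= => /andP[c0 cpi].
rewrite /G !cos_primitive0 !subr0 => E; rewrite -subr_ge0 E.
have cos0 : 0 <= cos c by apply: cos_ge0_pihalf; apply/andP; split; lra.
rewrite mulr_ge0 ?(ltW pi2) // exprSr -{1}[_ ^+ n]mulr1 -mulrBr mulr_ge0 ?exprn_ge0 //.
Qed.

Lemma cos_primitive_pihalfS n : cos_primitive n.+2 (pi / 2) =
  n.+1%:R / n.+2%:R * cos_primitive n (pi / 2).
Proof. by rewrite /= cos_pihalf expr0n mul0r add0r mulrA [_^-1 * _]mulrC. Qed.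

Lemma cos_primitive_even k :
  cos_primitive k.*2 (pi / 2) = wallis_ratio k * (pi / 2).
Proof.
elim: k => [|k IH]; first by rewrite /wallis_ratio big_ord0 mul1r.
rewrite doubleS cos_primitive_pihalfS IH wallis_ratioS mulrA; congr (_ * _).
rewrite mulrC -[k.*2.+2]addn2 -[k.*2.+1]addn1 !natrD -mul2n natrM //.
Qed.

Lemma cos_primitive_odd k :
  wallis_ratio k * (2 * k%:R + 1) * cos_primitive k.*2.+1 (pi / 2) = 1.
Proof.
elim: k => [|k IH].
  by rewrite /wallis_ratio big_ord0 /= sin_pihalf; ring.
rewrite -{}[RHS]IH doubleS cos_primitive_pihalfS wallis_ratioS.
rewrite -[k.*2.+3]addn3 -[k.*2.+2]addn2 !natrD -mul2n natrM -natr1.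
have k0 : 0 <= k%:R :> R by rewrite ler0n.
by field; apply/andP; split; apply: lt0r_neq0; lra.
Qed.

(* Comparing the integrals of [cos ^+ (2 k + 1)] and [cos ^+ (2 k + 2)]
   over [[0, pi / 2]] gives the sharp constant. *)
Lemma pi_wallis_ratio_le k : pi * k%:R * wallis_ratio k ^+ 2 <= 1 :> R.
Proof.
case: k => [|k]; first by rewrite mulr0 mul0r.
have := cos_primitive_pihalf_le k.*2.+1; rewrite -doubleS cos_primitive_even.
have := cos_primitive_odd k.
have E : wallis_ratio k.+1 * (2 * k%:R + 2) = wallis_ratio k * (2 * k%:R + 1) :> R.
  have k0 : 0 <= k%:R :> R by rewrite ler0n.
  by rewrite wallis_ratioS; field; apply: lt0r_neq0; lra.
rewrite -E => O le.
have c0 := wallis_ratio_gt0 (R := R) k.+1.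
have k0 : 0 <= k%:R :> R by rewrite ler0n.
rewrite -[leRHS]O; apply: le_trans (ler_wpM2l _ le); last by rewrite mulr_ge0; lra.
rewrite -natr1 [leLHS](_ : _ = wallis_ratio k.+1 * (2 * k%:R + 2) *
  (wallis_ratio k.+1 * (pi / 2))) //.
by field.
Qed.

End Wallis.

(** * Bounding an event by disjoint events of total mass 1 *)

Section Atoms.
Context {R : realType} {d : measure_display} {T : measurableType d}.
Context (P : probability T R).

(** The events [F i] may fail to cover the space, so [B] is bounded from outside: it misses each
    [F i] with i outside [D], hence lies in the complement of their union. *)
Lemma probability_le_sum_atoms (I : finType) (F : I -> set T) (q : I -> R)
    (D : pred I) (B : set T) :
  (forall i, measurable (F i)) -> trivIset setT F ->
  (forall i, P (F i) = (q i)%:E) -> \sum_i q i = 1 ->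
  measurable B -> (forall i o, F i o -> B o -> D i) ->
  (P B <= (\sum_(i | D i) q i)%:E)%E.
Proof.
move=> mF tF PF q1 mB BD.
pose r := [seq i <- enum I | ~~ D i].
pose U := \bigcup_(i in [set` r]) F i.
have mU : measurable U by apply: fin_bigcup_measurable => // i _.
have PU : P U = (\sum_(i | ~~ D i) q i)%:E.
  rewrite /U measure_fin_bigcup //; last exact: sub_trivIset tF.
  rewrite -fsbig_seq; last by rewrite filter_uniq // enum_uniq.
  rewrite big_filter big_enum_cond /= -sumEFin; apply: eq_bigr => i _; exact: PF.
have BU : B `<=` ~` U.
  move=> o Bo [i /=]; rewrite mem_filter => /andP[/negP nDi _] Fio.
  by apply: nDi; exact: BD Fio Bo.
apply: (@le_trans _ _ (P (~` U))).
  by apply: le_measure; rewrite ?inE //; exact: measurableC.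
rewrite probability_setC // PU -EFinB lee_fin -q1 (bigID D) /=.
by rewrite addrK.
Qed.

End Atoms.

(** * From random vectors to the cube *)

Section NoiseSensitivity.
Context {R : realType} {n : nat}.

Definition sign_tuple (x : {ffun 'I_n -> bool}) : n.-tuple R :=
  [tuple (-1) ^+ x i | i < n].

Lemma sign_tuple_inj : injective sign_tuple.
Proof.
move=> x y xy; apply/ffunP => i; have /(congr1 (fun u => tnth u i)) := xy.
by rewrite !tnth_mktuple => /eqP; rewrite (inj_eq signr_inj) => /eqP.
Qed.

Lemma sign_vectors_sign_tuple x : sign_vectors (sign_tuple x).
Proof. by move=> i; rewrite tnth_mktuple; case: (x i); [right|left]. Qed.

Lemma weighted_majority_sign_tuple w t x :
  weighted_majority w t (sign_tuple x) = cube_majority (tnth w) t x.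
Proof.
by rewrite /weighted_majority; under eq_bigr do rewrite tnth_mktuple.
Qed.

Lemma coordinatewise_mul_sign_tuple s x :
  coordinatewise_mul (sign_tuple s) (sign_tuple x) = sign_tuple (flip x s).
Proof.
by apply: eq_from_tnth => i; rewrite !tnth_mktuple ffunE signr_addb mulrC.
Qed.

Lemma measurable_tuple1 (v : n.-tuple R) : measurable [set v].
Proof.
have -> : [set v] = \bigcap_(i in [set: 'I_n]) ((@tnth n R)^~ i @^-1` [set tnth v i]).
  apply/seteqP; split=> [u -> i _ //|u uv]; apply: eq_from_tnth => i.
  exact: uv.
apply: fin_bigcap_measurable => // i _.
by rewrite -[X in measurable X]setTI; apply: measurable_tnth.
Qed.

Lemma measurable_weighted_majority d (T : measurableType d) (w : n.-tuple R) (t : R)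
    (f : T -> n.-tuple R) : measurable_fun setT f ->
  measurable_fun setT (fun o => weighted_majority w t (f o)).
Proof.
move=> /measurable_fun_tnthP mf.
have ms : measurable_fun setT (fun o => \sum_(i < n) tnth w i * tnth (f o) i - t).
  apply: measurable_funB => //; apply: measurable_sum => i.
  by apply: measurable_funM => //; exact: mf.
rewrite /weighted_majority /Num.sg; apply: measurable_fun_ifT => //.
  exact: measurable_fun_eqr.
by apply: measurable_fun_ifT => //; exact: measurable_fun_ltr.
Qed.

Context {d : measure_display} {T : measurableType d} {P : probability T R}.
Context {X sigma : {RV P >-> n.-tuple R}}.

Lemma probability_random_flips eps s : random_flips eps sigma ->
  P (sigma @^-1` [set sign_tuple s]) = (noise_weight eps s)%:E.
Proof.
move=> [ind flips].
have -> : sigma @^-1` [set sign_tuple s] =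
    [set o | forall i, i \in [set: 'I_n]%SET ->
       [set tnth (sign_tuple s) i] (tnth (sigma o) i)].
  apply/seteqP; split=> [z sz i _ | z H]; first by rewrite /= sz.
  by apply: eq_from_tnth => i; apply: H; rewrite inE.
rewrite (ind _ (fun i => [set tnth (sign_tuple s) i])) //.
rewrite /noise_weight -prodEFin; apply: eq_big => [i|i _]; first by rewrite inE.
rewrite tnth_mktuple; have [p1 pN1] := flips i.
by case: (s i).
Qed.

(** The events fixing both [X] and [sigma] to sign vectors have the product masses by independence,
    these sum to 1, and on each of them the cube decides disagreement. *)
Lemma noise_sensitivity_le eps w t : 0 <= eps <= 1 -> noise_model eps X sigma ->
  (noise_sensitivity X sigma w t <=
    (2 ^- n * disagreement (tnth w) t eps)%:E)%E.
Proof.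
move=> eps01 [uX flips ind].
pose F (p : {ffun 'I_n -> bool} * {ffun 'I_n -> bool}) :=
  X @^-1` [set sign_tuple p.1] `&` sigma @^-1` [set sign_tuple p.2].
pose D (p : {ffun 'I_n -> bool} * {ffun 'I_n -> bool}) :=
  cube_majority (tnth w) t p.1 != cube_majority (tnth w) t (flip p.1 p.2).
have mv (Z : {RV P >-> n.-tuple R}) v : measurable (Z @^-1` [set v]).
  by rewrite -[Z in measurable Z]setTI; apply: measurable_funP => //; exact: measurable_tuple1.
have -> : 2 ^- n * disagreement (tnth w) t eps =
    \sum_(p | D p) 2 ^- n * noise_weight eps p.2.
  rewrite /disagreement mulr_sumr [RHS]big_mkcond /=.
  rewrite -(pair_bigA _ (fun x s => if D (x, s) then 2 ^- n * noise_weight eps s else 0)) /=.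
  rewrite exchange_big /=; apply: eq_bigr => s _; rewrite mulrA mulr_sumr.
  by apply: eq_bigr => x _; rewrite /D /=; case: ifP; rewrite ?mulr1 ?mulr0.
apply: (@probability_le_sum_atoms _ _ _ _ _ F).
- by move=> p; apply: measurableI; exact: mv.
- move=> [x s] [y u] _ _ [z [[/= Xx sx] [Xy sy]]].
  by congr pair; apply: sign_tuple_inj; rewrite -?Xx -?Xy -?sx -?sy.
- move=> p; rewrite /F ind; try exact: measurable_tuple1.
  rewrite uX; last exact: sign_vectors_sign_tuple.
  by rewrite (probability_random_flips eps p.2 flips) -EFinM.
- rewrite -(pair_bigA _ (fun x s => 2 ^- n * noise_weight eps s)) /=.
  under eq_bigr do rewrite -mulr_sumr sum_noise_weight mulr1.
  rewrite sumr_const -[LHS]mulr_natr natr_card_cube card_ord mulVf //.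
- pose f o := weighted_majority w t (X o).
  pose g o := weighted_majority w t (noise_operator sigma X o).
  have mf : measurable_fun setT f by apply: measurable_weighted_majority.
  have mg : measurable_fun setT g.
    apply: measurable_weighted_majority; apply/measurable_fun_tnthP => i.
    rewrite [X in measurable_fun _ X](_ : _ = (fun o => tnth (sigma o) i * tnth (X o) i)).
      by apply: measurable_funM; apply: (measurableT_comp (measurable_tnth i)).
    by apply/funext => o /=; rewrite tnth_mktuple.
  rewrite (_ : [set _ | _] = (fun o => f o == g o) @^-1` [set false]).
    by rewrite -[X in measurable X]setTI; apply: measurable_fun_eqr.
  by apply/seteqP; split=> o /=; [move/eqP/negbTE|move/negbT/eqP].
- move=> [x s] o [/= Xo so]; rewrite /D /noise_operator /= Xo so.
  rewrite coordinatewise_mul_sign_tuple !weighted_majority_sign_tuple.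
  by move/eqP.
Qed.

End NoiseSensitivity.

(** * Choice of the number of blocks and passage to the limit *)

Section Asymptotics.
Context {R : realType}.

Lemma sqr_wallis_ratio_half_le m : (1 < m)%N ->
  wallis_ratio m./2 ^+ 2 * m.+1%:R <= 1 :> R.
Proof.
move=> m1; case E : m./2 => [|k]; first by lia.
apply: le_trans (sqr_wallis_ratio_le k); apply: ler_wpM2l; first exact: sqr_ge0.
by rewrite -natrM -natrD ler_nat; lia.
Qed.

Lemma disagreement_le_sqrt {I : finType} (w : I -> R) t (eps : R) :
  0 <= eps <= 1 / 2 ->
  disagreement w t eps <= 2 ^+ #|I| * (2 * Num.sqrt eps).
Proof.
move=> /andP[eps0 eps12]; have p2 : 0 < 2 ^+ #|I| :> R by rewrite exprn_gt0.
rewrite mulrC -ler_pdivrMr //; set q := _ / _; rewrite leNgt; apply/negP => ltq.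
have q0 : 0 < q by apply: le_lt_trans ltq; rewrite mulr_ge0 // sqrtr_ge0.
(* If q > 2 sqrt eps, then r lies strictly above eps, so 1 / r can guide the block count even when
   eps = 0. The contradiction will be r <= W ^ 2 <= 1 / (m + 1) < r, with W the Wallis ratio. *)
pose r := q ^+ 2 / 4.
have epsr : eps < r.
  rewrite /r ltr_pdivlMr // -[eps]sqr_sqrtr //.
  have s0 := sqrtr_ge0 eps; nra.
have r0 : 0 < r by exact: le_lt_trans epsr.
have ri0 : 0 <= r^-1 by rewrite invr_ge0 ltW.
have /andP[tr_le lt_tr] := truncn_itv ri0.
(* At least 2 blocks are needed for [sqr_wallis_ratio_half_le]; two are admissible because eps <= 1
   / 2. *)
pose m := maxn 2 (Num.truncn r^-1).
have m1 : (1 < m)%N by rewrite leq_max.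
have meps : m%:R * eps <= 1.
  rewrite /m /maxn; case: ltnP => _; last by lra.
  apply: (@le_trans _ _ (r^-1 * r)); last by rewrite mulVf ?lt0r_neq0.
  by apply: ler_pM => //; exact: ltW.
have rm : 1 < r * m.+1%:R.
  rewrite -[ltLHS](mulfV (lt0r_neq0 r0)) ltr_pM2l //.
  by apply: lt_le_trans lt_tr _; rewrite ler_nat ltnS leq_maxr.
have eps1 : 0 <= eps <= 1 by apply/andP; split; lra.
have := disagreement_le w t _ _ (ltnW m1) eps1 meps.
rewrite mulrC -ler_pdivrMr // -/q => qc.
have rc : r <= wallis_ratio m./2 ^+ 2.
  rewrite /r ler_pdivrMr //; nra.
have := sqr_wallis_ratio_half_le _ m1; apply/negP; rewrite -ltNge.
by apply: lt_le_trans rm _; apply: ler_wpM2r.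
Qed.

(** Take m the integer part of 1 / eps and k = m./2. Then 2 k eps >= 1 - 2 eps, and Wallis'
    inequality bounds pi * k * W ^ 2 by 1. *)
Lemma exists_block_count (eps : R) : 0 < eps <= 1 / 2 ->
  exists m, [/\ (0 < m)%N, m%:R * eps <= 1 &
    wallis_ratio m./2 ^+ 2 * (1 - 2 * eps) * pi <= 2 * eps].
Proof.
move=> /andP[eps0 eps12].
have ei0 : 0 <= eps^-1 by rewrite invr_ge0 ltW.
have /andP[tr_le lt_tr] := truncn_itv ei0.
exists (Num.truncn eps^-1); set m := Num.truncn _ in tr_le lt_tr *.
have em : 1 < eps * m.+1%:R.
  by rewrite -[ltLHS](mulfV (lt0r_neq0 eps0)) ltr_pM2l.
have m0 : (0 < m)%N.
  rewrite lt0n; apply/eqP => m0; move: em; rewrite m0; lra.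
split=> //.
  by rewrite -[leRHS](mulVf (lt0r_neq0 eps0)) ler_pM2r.
have := @pi_wallis_ratio_le R m./2; set k := m./2; set c := wallis_ratio k.
have mk : m.+1%:R <= 2 * k%:R + 2 :> R.
  by rewrite -natrM -natrD ler_nat /k; lia.
have c0 : 0 <= c ^+ 2 * pi by rewrite mulr_ge0 ?sqr_ge0 ?pi_ge0.
move=> H; rewrite mulrAC.
have : eps * (c ^+ 2 * pi * k%:R) <= eps by rewrite -[leRHS]mulr1 ler_pM2l //; lra.
have : 1 - 2 * eps <= 2 * (eps * k%:R) by nra.
move=> /(ler_wpM2l c0); lra.
Qed.

Lemma limsup_le_wallis (p : forall n : nat, n.-tuple R -> R -> \bar R) (c : R) :
  (forall n, (0 < n)%N -> forall w t, nonzero_weights w ->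
    (p n w t <= (c + wallis_ratio n./2)%:E)%E) ->
  (limsup_worst_case p <= c%:E)%E.
Proof.
move=> pc; apply/lee_addgt0Pr => e e0; rewrite -EFinD.
have e2 : 0 < e ^+ 2 by rewrite exprn_gt0.
(* For n >= N one has n + 1 > 1 / e ^ 2, so the Wallis ratio at [n./2] is at most e. *)
pose N := maxn 2 (Num.truncn (e ^+ 2)^-1).
rewrite /limsup_worst_case /limn_esup limf_esupE.
apply: (@le_trans _ _ _ _ _ (ereal_inf_lbound _)).
  exists [set n | (N <= n)%N] => //; exact: nbhs_infty_ge.
apply: ge_ereal_sup => _ [n /= Nn <-].
have n1 : (1 < n)%N by apply: leq_trans Nn; rewrite leq_max.
apply: ge_ereal_sup => _ [w w0 [t _ <-]].
apply: le_trans (pc n (ltnW n1) w t w0) _; rewrite lee_fin lerD2l.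
rewrite -ler_sqr ?nnegrE ?(ltW e0) ?(ltW (wallis_ratio_gt0 _)) //.
have n0 : 0 < n.+1%:R :> R by rewrite ltr0n.
rewrite -(ler_pM2r n0); apply: le_trans (sqr_wallis_ratio_half_le _ n1) _.
have ei0 : 0 <= (e ^+ 2)^-1 by rewrite invr_ge0 ltW.
have /andP[_ lt_tr] := truncn_itv ei0.
rewrite -[leLHS](mulfV (lt0r_neq0 e2)) ler_pM2l //; apply: le_trans (ltW lt_tr) _.
by rewrite ler_nat ltnS; apply: leq_trans Nn; rewrite leq_maxr.
Qed.

End Asymptotics.

Theorem theorem1p1 (R : realType) :
  (forall (d : measure_display) (T : measurableType d) (P : probability T R)
      (n : nat) (eps : R) (X sigma : {RV P >-> n.-tuple R})
      (w : n.-tuple R) (t : R),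
    (0 < n)%N -> 0 <= eps <= 1 / 2 -> noise_model eps X sigma ->
    nonzero_weights w ->
    (noise_sensitivity X sigma w t <= (2 * Num.sqrt eps)%:E)%E)
  /\
  (forall (d : R -> nat -> measure_display)
      (T : forall (eps : R) (n : nat), measurableType (d eps n))
      (P : forall (eps : R) (n : nat), probability (T eps n) R)
      (X sigma : forall (eps : R) (n : nat), {RV (P eps n) >-> n.-tuple R}),
    (forall (eps : R) (n : nat), 0 <= eps <= 1 -> (0 < n)%N ->
      noise_model eps (X eps n) (sigma eps n)) ->
    (limf_esup (fun eps : R =>
        limsup_worst_case
          (fun n => noise_sensitivity (X eps n) (sigma eps n))
        * ((Num.sqrt eps)^-1)%:E) 0^'+
       <= (Num.sqrt (2 / pi))%:E)%E).
Proof.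
split=> [d T P n eps X sigma w t n0 eps01 model w0|d T P X sigma model].
  have eps1 : 0 <= eps <= 1 by case/andP: eps01 => *; apply/andP; split; lra.
  apply: le_trans (noise_sensitivity_le _ w t eps1 model) _.
  rewrite lee_fin mulrC ler_pdivrMr ?exprn_gt0 // [leRHS]mulrC.
  by have := disagreement_le_sqrt (tnth w) t _ eps01; rewrite card_ord.
apply/lee_addgt0Pr => e e0; rewrite -EFinD.
set s := Num.sqrt (2 / pi).
have s0 : 0 < s by rewrite sqrtr_gt0 divr_gt0 // pi_gt0.
have se2 : 0 < (s + e) ^+ 2 by rewrite exprn_gt0 // addr_gt0.
(* Chosen so that (1 - 2 dl) (s + e) ^ 2 = s ^ 2: the loss 1 - 2 eps in the block count then fits
   into the slack e. *)
pose dl := (1 - s ^+ 2 / (s + e) ^+ 2) / 2.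
have dl0 : 0 < dl.
  rewrite divr_gt0 // subr_gt0 ltr_pdivrMr // mul1r; nra.
have dl1 : dl <= 1 / 2.
  rewrite /dl ler_pM2r ?invr_gt0 // lerBlDr lerDl divr_ge0 ?sqr_ge0 //.
have near0 : \forall eps \near (0 : R)^'+, 0 < eps < dl.
  near=> eps; apply/andP; split; near: eps; first exact: nbhs_right_gt.
  exact: nbhs_right_lt.
rewrite limf_esupE; apply: (@le_trans _ _ _ _ _ (ereal_inf_lbound _)).
  by exists [set eps : R | 0 < eps < dl].
apply: ge_ereal_sup => _ [eps /= /andP[eps0 epsd] <-].
have eps01 : 0 <= eps <= 1 by apply/andP; split; lra.
have eps12 : 0 < eps <= 1 / 2 by apply/andP; split; lra.
have [m [m0 meps mc]] := exists_block_count _ eps12.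
(* The block count m depends on eps alone, so the limit in n removes the other Wallis ratio. *)
apply: (@le_trans _ _ ((wallis_ratio m./2)%:E * ((Num.sqrt eps)^-1)%:E)%E).
  apply: lee_wpmul2r; first by rewrite lee_fin invr_ge0 sqrtr_ge0.
  apply: limsup_le_wallis => n n0 w t w0.
  apply: le_trans (noise_sensitivity_le _ w t eps01 (model _ _ eps01 n0)) _.
  rewrite lee_fin mulrC ler_pdivrMr ?exprn_gt0 // [leRHS]mulrC.
  exact: disagreement_nonzero_weights_le.
rewrite -EFinM lee_fin ler_pdivrMr ?sqrtr_gt0 //.
rewrite -ler_sqr ?nnegrE ?mulr_ge0 ?sqrtr_ge0 ?(ltW (wallis_ratio_gt0 _)) //; last first.
  by rewrite addr_ge0 ?ltW.
rewrite exprMn sqr_sqrtr ?(ltW eps0) //.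
have s2 : s ^+ 2 = 2 / pi by rewrite sqr_sqrtr // divr_ge0 // pi_ge0.
have pi0 : 0 < pi :> R by exact: pi_gt0.
have {}mc : wallis_ratio m./2 ^+ 2 * (1 - 2 * eps) <= eps * s ^+ 2.
  by rewrite s2 mulrA ler_pdivlMr // [leRHS]mulrC.
have epsd' : s ^+ 2 <= (1 - 2 * eps) * (s + e) ^+ 2.
  by rewrite -ler_pdivrMr //; move: epsd; rewrite /dl; lra.
have e1 : 0 < 1 - 2 * eps by lra.
rewrite -(ler_pM2r e1); apply: le_trans mc _.
rewrite [leRHS](_ : _ = eps * ((1 - 2 * eps) * (s + e) ^+ 2)); last by ring.
by rewrite ler_pM2l.
Unshelve. all: by end_near.
Qed.
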